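(* Let $N$ loads with parameters $\{a^i,d^i,p^i,\underline{E}^i,\bar{E}^i\}$, $i\in\mathcal{N}=\{1,\dots,N\}$, be partitioned into finitely many nonempty groups $\mathcal{N}_1,\dots,\mathcal{N}_K$, let $\tilde{\mathcal{P}}^k$ be the (reduced) high-dimensional polytope associated with the $k$-th group, and let $\mathbb{B}=\mathbb{B}(\underline{p},\bar{p},\underline{E},\bar{E})$ be a given nominal $m$-horizon virtual battery model. Suppose that for every $k$, $(s_k,r_k,W_k,V_k,G_k)=\mathrm{APP}(\tilde{\mathcal{P}}^k,\mathbb{B})$, i.e. it is an optimal solution of the linear program (APP) for $\tilde{\mathcal{P}}^k$ and $\mathbb{B}$. Put $$\lambda_k=\frac{1}{s_k},\quad \mu_k=\frac{-r_k}{s_k},\quad \lambda=\sum_k\lambda_k,\quad \mu=\sum_k\mu_k .$$ Then: 1. $\mathbb{B}_s:=\lambda\mathbb{B}+\mu$ is a sufficient battery, i.e. $\mathbb{B}_s\subset\mathcal{P}$, and it is the virtual battery $\mathbb{B}(\underline{p}_s,\bar{p}_s,\underline{E}_s,\bar{E}_s)$ with parameters $$\bar{p}_s=\lambda\bar{p}+\mu,\quad \underline{p}_s=\lambda\underline{p}+\mu,\quad \bar{E}_s=\lambda\bar{E}+\mathbf{1}_m^T\mu,\quad \underline{E}_s=\lambda\underline{E}+\mathbf{1}_m^T\mu .$$ 2. For every $u\in\mathbb{B}_s$, a scheduling policy is given by $$\tilde{u}_k=W_k\frac{\lambda_k}{\lambda}(u-\mu)+\lambda_kV_k,\qquad k=1,\dots,K,$$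 where $\tilde{u}_k$ denotes the (reduced) charging profiles of the loads in the $k$-th group; that is, there is a decomposition $u=\sum_{i\in\mathcal{N}}u^i$ with $u^i\in\mathcal{P}^i$ for all $i$ such that, for each $k$, the vector of reduced coordinates of $(u^i)_{i\in\mathcal{N}_k}$ equals $\tilde{u}_k$.
   Context: Notation: $m\ge1$ is the number of time slots (of unit length), $\mathbb{T}=\{1,\dots,m\}$, $\mathbf{1}_m$ is the all-ones column vector in $\mathbb{R}^m$, vector and matrix inequalities are elementwise, and $(u,v)$ denotes stacking of column vectors. Loads. For load $i$, $a^i<d^i$ are in $\mathbb{T}$, $\mathbb{A}^i=\{a^i,\dots,d^i\}$, $p^i>0$, $\underline{E}^i<\bar{E}^i$. Its set of admissible power profiles is $$\mathcal{P}^i=\Big\{u^i\in\mathbb{R}^m:\ u^i_t\in[0,p^i]\ \forall t\in\mathbb{A}^i,\ u^i_t=0\ \forall t\in\mathbb{T}\setminus\mathbb{A}^i,\ \mathbf{1}_m^Tu^i\in[\underline{E}^i,\bar{E}^i]\Big\}.$$ The aggregate flexibility $\mathcal{P}$ of the whole group of loads is the Minkowski sum $\mathcal{P}=\{\sum_{i\in\mathcal{N}}u^i:\ u^i\in\mathcal{P}^i\}$. Virtual battery. For $\underline{p},\bar{p}\in\mathbb{R}^m$ and $\underline{E},\bar{E}\in\mathbb{R}$, $$\mathbb{B}(\underline{p},\bar{p},\underline{E},\bar{E})=\{u\in\mathbb{R}^m:\ \underline{p}\le u\le\bar{p},\ \mathbf{1}_m^Tu\in[\underline{E},\bar{E}]\}.$$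 It is called a sufficient battery if it is contained in $\mathcal{P}$. It has the facet representation $\{u:Fu\le H\}$ with $F=[I_m,-I_m,\mathbf{1}_m,-\mathbf{1}_m]^T\in\mathbb{R}^{(2m+2)\times m}$ and $H=(\bar{p},-\underline{p},\bar{E},-\underline{E})$. The nominal model $\mathbb{B}$ is assumed full dimensional (it has an interior point in $\mathbb{R}^m$). Reduced polytope of a group. Fix a group $\mathcal{N}_k$. For $t\in\mathbb{T}$ let $N_t=\{i\in\mathcal{N}_k:t\in\mathbb{A}^i\}$, assumed nonempty for all $t$, let $j_t=\min N_t$, and for $i\in\mathcal{N}_k$ let $S_i=\{t\in\mathbb{A}^i:j_t=i\}$. Given charging profiles $u^i$, $i\in\mathcal{N}_k$, with group profile $z=\sum_{i\in\mathcal{N}_k}u^i$, the coordinates $u^i_t=0$ for $t\notin\mathbb{A}^i$ are dropped and the coordinates $u_t^{j_t}=z_t-\sum_{i\in N_t\setminus\{j_t\}}u^i_t$ are eliminated. The remaining coordinates, the reduced coordinates, form the vector $\tilde{u}=(\tilde{u}^i)_{i\in\mathcal{N}_k}$, with $\tilde{u}^i=[u^i_t]_{t\in\mathbb{A}^i\setminus S_i}$, of dimension $\tilde{m}_k=\sum_{i\in\mathcal{N}_k}(d^i-a^i+1)-m$. The polytope $\tilde{\mathcal{P}}^k\subset\mathbb{R}^{m+\tilde{m}_k}$ is the set of $(z,\tilde{u})$ satisfying $$0\le z_t-\sum_{i\in N_t\setminus\{j_t\}}u^i_t\le p^{j_t}\quad\forall t\in\mathbb{T},$$ $$0\le u^i_t\le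 p^i\quad\forall t\in\mathbb{T},\ i\in N_t\setminus\{j_t\},$$ $$\underline{E}^i\le\sum_{t\in\mathbb{A}^i\setminus S_i}u^i_t+\sum_{t\in S_i}\Big(z_t-\sum_{j\in N_t\setminus\{j_t\}}u^j_t\Big)\le\bar{E}^i\quad\forall i\in\mathcal{N}_k.$$ Write this system in matrix form as $B_k\begin{bmatrix}z\\ \tilde{u}\end{bmatrix}\le c_k$, with $n_k$ rows. The polytope $\tilde{\mathcal{P}}^k$ is assumed full dimensional. The linear program (APP) for $\tilde{\mathcal{P}}^k$ and $\mathbb{B}=\{u:Fu\le H\}$ is: minimize $s$ over $s\in\mathbb{R}$, $G\in\mathbb{R}^{n_k\times(2m+2)}$, $r\in\mathbb{R}^m$, $W\in\mathbb{R}^{\tilde{m}_k\times m}$, $V\in\mathbb{R}^{\tilde{m}_k}$ subject to $$s>0,\quad G\ge0,\quad GF=B_k\begin{bmatrix}I_m\\ W\end{bmatrix},\quad GH\le B_k\begin{bmatrix}r\\ -V\end{bmatrix}+s\,c_k.$$ Its optimal solution is denoted $(s_k,r_k,W_k,V_k,G_k)=\mathrm{APP}(\tilde{\mathcal{P}}^k,\mathbb{B})$. *)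

(* Defs.v *)
From HB Require Import structures.
From mathcomp Require Import all_boot all_order all_algebra.
From mathcomp Require Import all_classical all_reals all_analysis.
Set Implicit Arguments.
Unset Strict Implicit.
Unset Printing Implicit Defensive.
Import Order.TTheory GRing.Theory Num.Theory.
Import numFieldNormedType.Exports.
Local Open Scope classical_set_scope.
Local Open Scope ring_scope.

(* The slots 1, ..., m are encoded by 'I_m (slot t is the ordinal t - 1) and the
   loads by 'I_N.+1, so there is at least one load. *)

Definition mxle (R : realType) n p (A B : 'M[R]_(n, p)) : Prop :=
  forall i j, A i j <= B i j.

Notation "A <=m B" := (mxle A B) (at level 70, no associativity).

Section Loads.
Variables (R : realType) (m : nat).

Record load := Load {
  arrival : 'I_m;
  departure : 'I_m;
  pmax : R;
  Emin : R;
  Emax : R }.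

Definition valid_load (l : load) : Prop :=
  [/\ (arrival l < departure l)%N, 0 < pmax l & Emin l < Emax l].

Definition window (l : load) : {set 'I_m} :=
  [set t : 'I_m | (arrival l <= t)%N & (t <= departure l)%N].

Definition load_profiles (l : load) : set 'cV[R]_m :=
  [set u : 'cV[R]_m |
    [/\ forall t, t \in window l -> 0 <= u t 0 <= pmax l,
        forall t, t \notin window l -> u t 0 = 0
      & Emin l <= \sum_t u t 0 <= Emax l]].

Definition aggregate_flexibility N (L : 'I_N.+1 -> load) : set 'cV[R]_m :=
  [set z : 'cV[R]_m | exists u : 'I_N.+1 -> 'cV[R]_m,
     (forall i, load_profiles (L i) (u i)) /\ z = \sum_i u i].

End Loads.

Section Battery.
Variables (R : realType) (m : nat).

Definition battery (plo phi : 'cV[R]_m) (Elo Ehi : R) : set 'cV[R]_m :=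
  [set u : 'cV[R]_m | [/\ plo <=m u, u <=m phi & Elo <= \sum_t u t 0 <= Ehi]].

Definition sufficient_battery N (L : 'I_N.+1 -> load R m) (B : set 'cV[R]_m) :=
  B `<=` aggregate_flexibility L.

Definition battery_F : 'M[R]_(m + (m + (1 + 1)), m) :=
  (row_mx 1%:M (row_mx (- 1%:M) (row_mx (const_mx 1) (const_mx (- 1)))))^T.

Definition battery_H (plo phi : 'cV[R]_m) (Elo Ehi : R) :
    'cV[R]_(m + (m + (1 + 1))) :=
  col_mx phi (col_mx (- plo) (col_mx (const_mx Ehi) (const_mx (- Elo)))).

End Battery.
Arguments battery_F : clear implicits.

Section Reduction.
Variables (R : realType) (m N : nat) (L : 'I_N.+1 -> load R m).
Variable S : {set 'I_N.+1}.

(* N_t for the group S *)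
Definition active (t : 'I_m) : {set 'I_N.+1} :=
  [set i in S | t \in window (L i)].

(* j_t = min N_t; the default ord0 is irrelevant when N_t is nonempty. *)
Definition lead (t : 'I_m) : 'I_N.+1 :=
  [arg min_(i < ord0 in active t) (i : nat)]%N.

(* S_i *)
Definition lead_slots (i : 'I_N.+1) : {set 'I_m} :=
  [set t in window (L i) | lead t == i].

(* The index pairs (i, t) of the reduced coordinates u^i_t. They are enumerated
   lexicographically, load first, which is the stacking order of u~. *)
Definition reduced : {set 'I_N.+1 * 'I_m} :=
  [set it | (it.1 \in S) && (it.2 \in window (L it.1) :\: lead_slots it.1)].

Definition reduce (u : 'I_N.+1 -> 'cV[R]_m) : 'cV[R]_#|reduced| :=
  \col_c u (enum_val c).1 (enum_val c).2 0.

(* The coordinate u^i_t of u~; the sum has exactly one term when (i, t) is a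
   reduced index pair, and none otherwise. *)
Definition coordr (u : 'cV[R]_#|reduced|) (i : 'I_N.+1) (t : 'I_m) : R :=
  \sum_(c | enum_val c == (i, t)) u c 0.

Definition lead_coord (z : 'cV[R]_m) (u : 'cV[R]_#|reduced|) (t : 'I_m) : R :=
  z t 0 - \sum_(i in active t :\ lead t) coordr u i t.

Definition reduced_polytope : set 'cV[R]_(m + #|reduced|) :=
  [set x : 'cV[R]_(m + #|reduced|) |
    let z := usubmx x in let u := dsubmx x in
    [/\ forall t, 0 <= lead_coord z u t <= pmax (L (lead t)),
        forall t i, i \in active t :\ lead t -> 0 <= coordr u i t <= pmax (L i)
      & forall i, i \in S ->
          Emin (L i) <=
            \sum_(t in window (L i) :\: lead_slots i) coordr u i t
            + \sum_(t in lead_slots i) lead_coord z u t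
          <= Emax (L i)]].

(* Coefficients of (z, u~) in the eliminated coordinates (one row per slot), in
   the reduced coordinates, and in the energies (one row per load of S). *)
Definition lead_mx : 'M[R]_(m, m + #|reduced|) :=
  row_mx 1%:M (- \matrix_(t, c) ((enum_val c).2 == t)%:R).

Definition coord_mx : 'M[R]_(#|reduced|, m + #|reduced|) := row_mx 0 1%:M.

Definition energy_mx : 'M[R]_(#|S|, m + #|reduced|) :=
  row_mx 0 (\matrix_(a, c) ((enum_val c).1 == enum_val a)%:R)
  + (\matrix_(a, t) (t \in lead_slots (enum_val a))%:R) *m lead_mx.

Definition nrows : nat :=
  (m + (m + (#|reduced| + (#|reduced| + (#|S| + #|S|)))))%N.

Definition polytope_B : 'M[R]_(nrows, m + #|reduced|) :=
  col_mx (- lead_mx) (col_mx lead_mx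
    (col_mx (- coord_mx) (col_mx coord_mx
      (col_mx (- energy_mx) energy_mx)))).

Definition polytope_c : 'cV[R]_nrows :=
  col_mx 0 (col_mx (\col_t pmax (L (lead t)))
    (col_mx 0 (col_mx (\col_c pmax (L (enum_val c).1))
      (col_mx (- \col_a Emin (L (enum_val a))) (\col_a Emax (L (enum_val a))))))).

End Reduction.
Arguments reduced_polytope {R m N} L S _.

Section LinearProgram.
Variables (R : realType) (n m q h : nat).
Variables (B : 'M[R]_(n, m + q)) (c : 'cV[R]_n).
Variables (F : 'M[R]_(h, m)) (H : 'cV[R]_h).

Definition app_feasible (s : R) (r : 'cV[R]_m) (W : 'M[R]_(q, m))
    (V : 'cV[R]_q) (G : 'M[R]_(n, h)) : Prop :=
  [/\ 0 < s, 0 <=m G, G *m F = B *m col_mx 1%:M W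
    & G *m H <=m B *m col_mx r (- V) + s *: c].

Definition app_optimal (s : R) (r : 'cV[R]_m) (W : 'M[R]_(q, m))
    (V : 'cV[R]_q) (G : 'M[R]_(n, h)) : Prop :=
  app_feasible s r W V G /\
  forall s' r' W' V' G', app_feasible s' r' W' V' G' -> s <= s'.

End LinearProgram.

(* The interior is taken in the entrywise topology of R^n. *)
Definition full_dimensional (R : realType) n (A : set 'cV[R]_n) : Prop :=
  A° !=set0.

Lemma mxle_col (R : realType) n1 n2 p (A1 B1 : 'M[R]_(n1, p))
    (A2 B2 : 'M[R]_(n2, p)) :
  col_mx A1 A2 <=m col_mx B1 B2 <-> A1 <=m B1 /\ A2 <=m B2.
Proof.
split=> [le_AB | [le1 le2] i j].
  by split=> i j; [have := le_AB (lshift _ i) j; rewrite !col_mxEu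
                  |have := le_AB (rshift _ i) j; rewrite !col_mxEd].
by rewrite !mxE; case: fintype.split => k; [apply: le1 | apply: le2].
Qed.

Lemma battery_facetE (R : realType) m (plo phi : 'cV[R]_m) (Elo Ehi : R) :
  battery plo phi Elo Ehi =
  [set u | battery_F R m *m u <=m battery_H plo phi Elo Ehi].
Proof.
have sumE a (u : 'cV[R]_m) i j :
    ((const_mx a : 'cV[R]_m)^T *m u) i j = a * \sum_t (u t 0) :> R.
  rewrite [j]ord1 mxE mulr_sumr; apply: eq_bigr => t _.
  by rewrite !mxE.
apply/seteqP; split=> u /=;
  rewrite /battery_F !tr_row_mx !mul_col_mx !mxle_col linearN /= trmx1 mulNmx
    !mul1mx.
  case=> plo_u u_phi /andP[Elo_u u_Ehi].
  split=> //; split; last split; move=> i j.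
  - by rewrite !mxE lerN2.
  - by rewrite sumE !mxE mul1r.
  - by rewrite sumE !mxE mulN1r lerN2.
case=> u_phi [plo_u [/(_ 0 0) + /(_ 0 0)]].
rewrite !sumE mul1r mulN1r !mxE lerN2 => u_Ehi Elo_u.
split=> //; last by rewrite Elo_u.
by move=> i j; have := plo_u i j; rewrite !mxE lerN2.
Qed.

Section ReductionTheory.
Variables (R : realType) (m N : nat) (L : 'I_N.+1 -> load R m).
Variable S : {set 'I_N.+1}.

Lemma reducedE i t :
  ((i, t) \in reduced L S) = (i \in active L S t :\ lead L S t).
Proof.
rewrite !inE /= -!andbA [lead _ _ _ == i]eq_sym.
by case: (i \in S); case: (i == _); case: (_ <= _)%N; case: (_ <= _)%N.
Qed.

Lemma coordrE (u : 'cV[R]_#|reduced L S|) c :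
  coordr u (enum_val c).1 (enum_val c).2 = u c 0.
Proof.
rewrite /coordr -surjective_pairing (big_pred1 c) // => c'.
by rewrite (inj_eq enum_val_inj).
Qed.

Lemma sum_coordr_slot (u : 'cV[R]_#|reduced L S|) t :
  \sum_(i in active L S t :\ lead L S t) coordr u i t =
  \sum_(c | (enum_val c).2 == t) u c 0.
Proof.
rewrite (partition_big (fun c => (enum_val c).1)
  (mem (active L S t :\ lead L S t))) /=; last first.
  move=> c /eqP <-; rewrite -reducedE -surjective_pairing; exact: enum_valP.
apply: eq_bigr => i _; apply: eq_bigl => c.
by rewrite -pair_eqE /= andbC.
Qed.

Lemma sum_coordr_load (u : 'cV[R]_#|reduced L S|) i : i \in S ->
  \sum_(t in window (L i) :\: lead_slots L S i) coordr u i t =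
  \sum_(c | (enum_val c).1 == i) u c 0.
Proof.
move=> Si; rewrite (partition_big (fun c => (enum_val c).2)
  (mem (window (L i) :\: lead_slots L S i))) /=; last first.
  by move=> c /eqP <-; have := enum_valP c; rewrite inE => /andP[].
by apply: eq_bigr => t _; apply: eq_bigl => c; rewrite -pair_eqE.
Qed.

Lemma lead_mxE (x : 'cV[R]_(m + #|reduced L S|)) t :
  (lead_mx L S *m x) t 0 = lead_coord (usubmx x) (dsubmx x) t.
Proof.
rewrite -{1}[x]vsubmxK mul_row_col mul1mx mulNmx !mxE /lead_coord !mxE.
congr (_ - _); rewrite sum_coordr_slot [RHS]big_mkcond.
by apply: eq_bigr => c _; rewrite !mxE; case: eqP; rewrite ?mul1r ?mul0r.
Qed.

Lemma coord_mxE (x : 'cV[R]_(m + #|reduced L S|)) c :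
  (coord_mx L S *m x) c 0 = dsubmx x c 0.
Proof. by rewrite -{1}[x]vsubmxK mul_row_col mul0mx mul1mx add0r. Qed.

Lemma energy_mxE (x : 'cV[R]_(m + #|reduced L S|)) a (i := enum_val a) :
  (energy_mx L S *m x) a 0 =
  \sum_(t in window (L i) :\: lead_slots L S i) coordr (dsubmx x) i t
  + \sum_(t in lead_slots L S i) lead_coord (usubmx x) (dsubmx x) t.
Proof.
rewrite mulmxDl mxE -mulmxA; congr (_ + _).
  rewrite -{1}[x]vsubmxK mul_row_col mul0mx add0r mxE.
  rewrite sum_coordr_load ?enum_valP // [RHS]big_mkcond.
  by apply: eq_bigr => c _; rewrite !mxE; case: eqP; rewrite ?mul1r ?mul0r.
rewrite mxE [RHS]big_mkcond; apply: eq_bigr => t _.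
by rewrite lead_mxE mxE -/i; case: ifP; rewrite ?mul1r ?mul0r.
Qed.

Lemma reduced_polytopeE :
  reduced_polytope L S = [set x | polytope_B L S *m x <=m polytope_c L S].
Proof.
apply/seteqP; split=> x /=;
  rewrite /polytope_B /polytope_c !mul_col_mx !mulNmx !mxle_col.
  case=> lead_x coord_x energy_x.
  have coordb c : 0 <= dsubmx x c 0 <= pmax (L (enum_val c).1).
    have := coord_x (enum_val c).2 (enum_val c).1.
    by rewrite coordrE -reducedE -surjective_pairing; apply; apply: enum_valP.
  have energyb a := energy_x _ (enum_valP a).
  split; last split; last split; last split; last split;
    move=> i j; rewrite [j]ord1.
  - by rewrite mxE lead_mxE mxE oppr_le0; have /andP[] := lead_x i.
  - by rewrite lead_mxE mxE; have /andP[] := lead_x i.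
  - by rewrite mxE coord_mxE [leRHS]mxE oppr_le0; have /andP[] := coordb i.
  - by rewrite coord_mxE [leRHS]mxE; have /andP[] := coordb i.
  - by rewrite mxE energy_mxE !mxE lerN2; have /andP[] := energyb i.
  - by rewrite energy_mxE mxE; have /andP[] := energyb i.
case=> l0 [l1 [c0 [c1 [e0 e1]]]]; split.
- move=> t; apply/andP; split.
    by have := l0 t 0; rewrite mxE lead_mxE [leRHS]mxE oppr_le0.
  by have := l1 t 0; rewrite lead_mxE mxE.
- move=> t i; rewrite -reducedE => it_r.
  have [c def_c] : exists c : 'I_#|reduced L S|, (i, t) = enum_val c.
    by exists (enum_rank_in it_r (i, t)); rewrite enum_rankK_in.
  have := coordrE (dsubmx x) c; rewrite -def_c /= => ->; apply/andP; split.
    by have := c0 c 0; rewrite mxE coord_mxE [leRHS]mxE oppr_le0.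
  by have := c1 c 0; rewrite coord_mxE [leRHS]mxE -def_c.
- move=> i Si.
  have [a ->] : exists a : 'I_#|S|, i = enum_val a.
    by exists (enum_rank_in Si i); rewrite enum_rankK_in.
  apply/andP; split; last by have := e1 a 0; rewrite energy_mxE mxE.
  by have := e0 a 0; rewrite mxE energy_mxE !mxE lerN2.
Qed.

Lemma leadP t : active L S t != finset.set0 -> lead L S t \in active L S t.
Proof.
move=> /finset.set0Pn[i0 i0P]; rewrite /lead /arg_min /extremum.
case: pickP => [i /andP[] // | /=].
case: (arg_minnP (fun i : 'I_N.+1 => i : nat) i0P) => i iP imin /(_ i) /negP[].
by apply/andP; split=> //; apply/forallP => j; apply/implyP => /imin.
Qed.

Lemma card_window (l : load R m) : (arrival l <= departure l)%N ->
  #|window l| = (departure l - arrival l + 1)%N.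
Proof.
move=> le_ad; rewrite -sum1_card.
rewrite (eq_bigl (fun t : 'I_m => (arrival l <= t) && (t < (departure l).+1))%N).
  rewrite big_ord_narrow_cond /=.
  rewrite -(big_geq_mkord _ _ xpredT (fun _ => 1%N)) sum_nat_const_nat muln1.
  by rewrite subSn // addn1.
by move=> t; rewrite inE.
Qed.

Lemma card_reduced :
  (forall i, i \in S -> (arrival (L i) <= departure (L i))%N) ->
  (forall t, active L S t != finset.set0) ->
  #|reduced L S| =
  (\sum_(i in S) (departure (L i) - arrival (L i) + 1) - m)%N.
Proof.
move=> le_ad act.
pose U := [set it | (it.1 \in S) && (it.2 \in window (L it.1))]%SET.
pose Z := [set (lead L S t, t) | t : 'I_m].
have ZU : Z \subset U.
  apply/fintype.subsetP => _ /imsetP[t _ ->]; rewrite inE /=.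
  by have := leadP (act t); rewrite inE.
have cardZ : #|Z| = m.
  by rewrite card_imset ?card_ord // => t t' [].
have cardU : #|U| = (\sum_(i in S) #|window (L i)|)%N.
  rewrite -sum1_card (partition_big fst (mem S)) /= => [|it]; last first.
    by rewrite inE => /andP[].
  apply: eq_bigr => i Si; rewrite -sum1_card.
  rewrite (reindex_onto (pair i) snd) => [|[j t] /=]; last first.
    by case/andP=> _ /eqP->.
  by apply: eq_bigl => t; rewrite !inE /= Si !eqxx !andbT.
have -> : reduced L S = U :\: Z.
  apply/setP => -[i t]; rewrite [in RHS]inE reducedE.
  have -> : ((i, t) \in Z) = (i == lead L S t).
    by apply/imsetP/eqP => [[t' _ [-> ->]] // | ->]; exists t.
  by rewrite !inE.
rewrite cardsD (finset.setIidPr ZU) cardZ cardU.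
by congr (_ - _)%N; apply: eq_bigr => i /le_ad /card_window.
Qed.

End ReductionTheory.

(* Main.v *)
Require Import Defs.
From HB Require Import structures.
From mathcomp Require Import all_boot all_order all_algebra.
From mathcomp Require Import all_classical all_reals all_analysis.
Set Implicit Arguments.
Unset Strict Implicit.
Unset Printing Implicit Defensive.
Import Order.TTheory GRing.Theory Num.Theory.
Import numFieldNormedType.Exports.
Local Open Scope classical_set_scope.
Local Open Scope ring_scope.

(** The linear program (APP) encodes an inclusion of polytopes by means of the
    multipliers of the affine Farkas lemma: multiplying the facet inequalities
    [F w <= H] of the nominal battery by the nonnegative matrix [G] and using
    the constraints on [G] gives [B (w - r, W w + V) <= s c], so that after
    division by [s > 0] the point [(lambda_k w + mu_k, lambda_k (W w + V))] lies
    in the reduced polytope of the group ([app_feasible_sound]).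

    A point [(z, x)] of the reduced polytope encodes a family of
    admissible profiles of the loads of the group adding up to [z]: in each
    slot the leading load takes what the reduced coordinates leave of [z]
    ([unreduce] and the lemmas on it).

    Finally every [u] in [lambda B + mu] is [lambda w + mu] for one [w] of the
    nominal battery, that is, the sum over the groups of
    [lambda_k w + mu_k].  The same [w] serves all groups, and
    [(lambda_k / lambda) (u - mu) = lambda_k w], which gives the announced
    policy.  Since the groups partition the loads, the profiles obtained in
    the groups combine into one family indexed by all loads.  That
    [lambda B + mu] is again a battery holds because [lambda > 0], the number
    of groups being nonzero. *)

(** A feasible point of (APP) certifies an inclusion: [G] is a matrix of Farkas
    multipliers deriving the inequalities of the image polytope from those of
    the polyhedron [F w <= H]. *)
Lemma app_feasible_sound (R : realType) (n m q h : nat) (B : 'M[R]_(n, m + q))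
    (c : 'cV[R]_n) (F : 'M[R]_(h, m)) (H : 'cV[R]_h) (s : R) (r : 'cV[R]_m)
    (W : 'M[R]_(q, m)) (V : 'cV[R]_q) (G : 'M[R]_(n, h)) (w : 'cV[R]_m) :
  app_feasible B c F H s r W V G -> F *m w <=m H ->
  B *m col_mx (s^-1 *: (w - r)) (s^-1 *: (W *m w + V)) <=m c.
Proof.
case=> s_gt0 G_ge0 GF GH Fw i j.
have le_GF : (G *m (F *m w)) i j <= (G *m H) i j.
  rewrite !mxE; apply: ler_sum => l _; apply: ler_wpM2l (Fw l j).
  by have := G_ge0 i l; rewrite mxE.
have {}le_GF := le_trans le_GF (GH i j).
have col_w : col_mx (w - r) (W *m w + V)
    = col_mx 1%:M W *m w - col_mx r (- V).
  by rewrite mul_col_mx mul1mx opp_col_mx add_col_mx opprK.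
rewrite -scale_col_mx -scalemxAr col_w mulmxBr mulmxA -GF -mulmxA.
rewrite [leLHS]mxE ler_pdivrMl // [leLHS]mxE [X in _ + X <= _]mxE lerBlDl.
by move: le_GF; rewrite [X in _ <= X -> _]mxE [X in _ <= _ + X -> _]mxE.
Qed.

Lemma battery_affine (R : realType) (m : nat) (plo phi : 'cV[R]_m)
    (Elo Ehi lambda : R) (mu : 'cV[R]_m) : 0 < lambda ->
  [set lambda *: u + mu | u in battery plo phi Elo Ehi] =
  battery (lambda *: plo + mu) (lambda *: phi + mu)
    (lambda * Elo + \sum_t mu t 0) (lambda * Ehi + \sum_t mu t 0).
Proof.
move=> l_gt0.
have sumE (u : 'cV[R]_m) :
    \sum_t (lambda *: u + mu) t 0 = lambda * (\sum_t u t 0) + \sum_t mu t 0.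
  rewrite mulr_sumr -big_split; apply: eq_bigr => t _.
  by rewrite !mxE.
have leE (u v : 'cV[R]_m) :
    (lambda *: u + mu <=m lambda *: v + mu) <-> (u <=m v).
  split=> le_uv i j; have := le_uv i j; rewrite !mxE lerD2r ler_pM2l //.
have battE (u : 'cV[R]_m) :
    battery plo phi Elo Ehi u <->
    battery (lambda *: plo + mu) (lambda *: phi + mu)
      (lambda * Elo + \sum_t mu t 0) (lambda * Ehi + \sum_t mu t 0)
      (lambda *: u + mu).
  rewrite /battery /= sumE !lerD2r !ler_pM2l //.
  by split=> -[/leE ? /leE ? ?].
apply/seteqP; split=> [_ [u /battE ? <-] // | u].
have -> : u = lambda *: (lambda^-1 *: (u - mu)) + mu.
  by rewrite scalerA divff ?gt_eqF // scale1r subrK.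
by move=> /battE; exists (lambda^-1 *: (u - mu)).
Qed.

Section Unreduce.
Variables (R : realType) (m N : nat) (L : 'I_N.+1 -> load R m).
Variable S : {set 'I_N.+1}.
Variables (z : 'cV[R]_m) (x : 'cV[R]_#|reduced L S|).

Definition unreduce (i : 'I_N.+1) : 'cV[R]_m :=
  \col_t (if t \notin window (L i) then 0
          else if lead L S t == i then lead_coord z x t else coordr x i t).

Lemma reduce_unreduce : reduce L S unreduce = x.
Proof.
apply/matrixP => c j; rewrite [j]ord1 !mxE.
have := enum_valP c; rewrite {1}[enum_val c]surjective_pairing reducedE !inE /=.
case/andP=> ne_lead /andP[_ ->] /=.
by rewrite eq_sym (negPf ne_lead) coordrE.
Qed.

(** In each slot the leading load supplies exactly what the other active loads
    leave of [z]; a slot without active load would have nobody to do so. *)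
Lemma sum_unreduce : (forall t, active L S t != finset.set0) ->
  \sum_(i in S) unreduce i = z.
Proof.
move=> act; apply/matrixP => t j; rewrite [j]ord1 summxE.
have lead_t := leadP (act t).
transitivity (\sum_(i in active L S t)
    (if lead L S t == i then lead_coord z x t else coordr x i t)).
  rewrite big_mkcond [RHS]big_mkcond; apply: eq_bigr => i _.
  by rewrite !mxE !inE; case: (i \in S) => //=; case: (_ && _).
rewrite (big_setD1 _ lead_t) /= eqxx -[RHS](subrK
  (\sum_(i in active L S t :\ lead L S t) coordr x i t)).
congr (_ + _); apply: eq_bigr => i.
by rewrite !inE eq_sym => /andP[/negPf ->].
Qed.

(** The constraints of the reduced polytope are those of the individual loads
    after elimination: the bounds on the power of load [i] come from the first
    family in the slots it leads and from the second in the others, and its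
    energy is split in the same way. *)
Lemma load_profiles_unreduce i :
  reduced_polytope L S (col_mx z x) -> i \in S ->
  load_profiles (L i) (unreduce i).
Proof.
rewrite /reduced_polytope /= col_mxKu col_mxKd => -[leadb coordb energyb] Si.
split=> [t wt|t wt|].
- rewrite mxE wt /=; case: eqP => [<- // | /eqP ne_lead].
  by apply: coordb; rewrite !inE eq_sym ne_lead Si; move: wt; rewrite inE.
- by rewrite mxE wt.
have -> : \sum_t unreduce i t 0 =
    \sum_(t in window (L i) :\: lead_slots L S i) coordr x i t
    + \sum_(t in lead_slots L S i) lead_coord z x t.
  rewrite [X in X + _]big_mkcond [X in _ + X]big_mkcond -big_split /=.
  apply: eq_bigr => t _; rewrite mxE !inE.
  by case: (_ && _); case: (_ == _); rewrite /= ?addr0 ?add0r.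
exact: energyb.
Qed.

End Unreduce.

Theorem theorem2 (R : realType) (m N K : nat) (m_ge1 : (1 <= m)%N)
  (L : 'I_N.+1 -> load R m) (L_valid : forall i, valid_load (L i))
  (Nk : 'I_K -> {set 'I_N.+1}) (Nk_inj : injective Nk)
  (Nk_part : finset.partition [set Nk k | k : 'I_K] [set: 'I_N.+1])
  (Nk_active : forall k t, active L (Nk k) t != finset.set0)
  (Nk_full : forall k, full_dimensional (reduced_polytope L (Nk k)))
  (plo phi : 'cV[R]_m) (Elo Ehi : R)
  (B_full : full_dimensional (battery plo phi Elo Ehi))
  (s : 'I_K -> R) (r : 'I_K -> 'cV[R]_m)
  (W : forall k, 'M[R]_(#|reduced L (Nk k)|, m))
  (V : forall k, 'cV[R]_#|reduced L (Nk k)|)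
  (G : forall k, 'M[R]_(nrows L (Nk k), m + (m + (1 + 1))))
  (app : forall k,
     app_optimal (polytope_B L (Nk k)) (polytope_c L (Nk k))
       (battery_F R m) (battery_H plo phi Elo Ehi)
       (s k) (r k) (W k) (V k) (G k)) :
  let lambdak k := 1 / s k in
  let muk k := (s k)^-1 *: - r k in
  let lambda := \sum_k lambdak k in
  let mu := \sum_k muk k in
  let Bs := [set lambda *: u + mu | u in battery plo phi Elo Ehi] in
  [/\ sufficient_battery L Bs,
      Bs = battery (lambda *: plo + mu) (lambda *: phi + mu)
             (lambda * Elo + \sum_t mu t 0) (lambda * Ehi + \sum_t mu t 0)
    & forall u, Bs u ->
        exists v : 'I_N.+1 -> 'cV[R]_m,
          [/\ u = \sum_i v i,
              forall i, load_profiles (L i) (v i)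
            & forall k, reduce L (Nk k) v =
                W k *m ((lambdak k / lambda) *: (u - mu)) + lambdak k *: V k]].
Proof.
move=> lambdak muk lambda mu Bs.
have group_ex i : exists k, i \in Nk k.
  have := finset.in_setT i; rewrite -(cover_partition Nk_part).
  by case/finset.bigcupP=> _ /imsetP[k _ ->]; exists k.
have group_uniq i k k' : i \in Nk k -> i \in Nk k' -> k' = k.
  move=> ik ik'; apply: Nk_inj.
  have tI := partition_trivIset Nk_part.
  rewrite -(def_pblock tI (imset_f _ _) ik') //.
  by rewrite -(def_pblock tI (imset_f _ _) ik).
have s_gt0 k : 0 < s k by case: (app k) => -[].
have lambda_gt0 : 0 < lambda.
  have [k0 _] := group_ex ord0.
  rewrite /lambda (bigD1 k0) //= ltr_wpDr ?divr_gt0 // sumr_ge0 // => k _.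
  by rewrite divr_ge0 // ltW.
have policy u : Bs u -> exists v : 'I_N.+1 -> 'cV[R]_m,
    [/\ u = \sum_i v i,
        forall i, load_profiles (L i) (v i)
      & forall k, reduce L (Nk k) v =
          W k *m ((lambdak k / lambda) *: (u - mu)) + lambdak k *: V k].
  case=> w; rewrite battery_facetE /= => Fw <-.
  pose z k := (s k)^-1 *: (w - r k).
  pose x k := (s k)^-1 *: (W k *m w + V k).
  have zx_red k : reduced_polytope L (Nk k) (col_mx (z k) (x k)).
    by rewrite reduced_polytopeE; apply: (app_feasible_sound (app k).1 Fw).
  (* A sum with exactly one term: it selects the group of load i. *)
  pose v i := \sum_(k | i \in Nk k) unreduce (z k) (x k) i.
  have vE k i : i \in Nk k -> v i = unreduce (z k) (x k) i.
    move=> ik; rewrite /v (big_pred1 k) // => k'.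
    by apply/idP/eqP => [/(group_uniq _ _ _ ik) | ->].
  exists v; split.
  - rewrite (exchange_big_dep xpredT) //=.
    under eq_bigr => k _ do rewrite sum_unreduce //.
    rewrite /lambda scaler_suml -big_split; apply: eq_bigr => k _.
    by rewrite /z /lambdak /muk div1r scalerDr.
  - move=> i; have [k ik] := group_ex i.
    by rewrite (vE k) //; apply: load_profiles_unreduce.
  move=> k; rewrite addrK scalerA divfK ?gt_eqF // /lambdak div1r.
  rewrite -scalemxAr -scalerDr -/(x k) -[RHS](reduce_unreduce (z k)).
  apply/matrixP => c j; rewrite !mxE (vE k) ?mxE //.
  by have := enum_valP c; rewrite inE => /andP[].
split; last exact: policy.
  by move=> u /policy[v [u_sum v_adm _]]; exists v.
exact: battery_affine.
Qed.
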